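(* Let $n>p\ge 2$ be integers and let $G\in\mathbb{G}_n^p$, i.e. $G$ is a connected simple graph with $n$ vertices, exactly $p$ of which are pendant. Write $2n-p-2=k(n-p)+r$ with integers $k\ge 2$ and $0\le r\le n-p-1$. Then $$\prod\nolimits_1(G)\ge p^2\,2^{2(n-p-1)}\quad\text{and}\quad \prod\nolimits_2(G)\ge (k+1)^{r(k+1)}\,k^{k(n-p-r)},$$ where equality holds in the first inequality if and only if $G\in\mathcal{A}_n^1$, and in the second if and only if $G\in\mathcal{A}_n^2$.
   Context: All graphs are finite, simple and connected. $d(u)$ is the degree of a vertex $u$; a pendant vertex is a vertex of degree $1$. The first and second multiplicative Zagreb indices are $\prod_1(G)=\prod_{u\in V(G)}d(u)^2$ and $\prod_2(G)=\prod_{uv\in E(G)}d(u)d(v)=\prod_{u\in V(G)}d(u)^{d(u)}$. $\mathbb{G}_n^p$ is the set of connected graphs with $n$ vertices and exactly $p\ge2$ pendant vertices. $\mathcal{A}_n^1$ is the set of (connected) graphs with degree sequence $(p,\underbrace{2,\ldots,2}_{n-p-1},\underbrace{1,\ldots,1}_{p})$. $\mathcal{A}_n^2$ is the set of (connected) graphs with degree sequence $(\underbrace{k+1,\ldots,k+1}_{r},\underbrace{k,\ldots,k}_{n-p-r},\underbrace{1,\ldots,1}_{p})$, where $k,r$ are the integers determined by $2n-p-2=k(n-p)+r$, $k\ge2$, $0\le r\le n-p-1$. *)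

(* Defs.v *)
From mathcomp Require Import all_boot.

Set Implicit Arguments.
Unset Strict Implicit.
Unset Printing Implicit Defensive.

Record sgraph := SGraph {
  vertex :> finType;
  adj : rel vertex;
  adj_sym : symmetric adj;
  adj_irrefl : irreflexive adj
}.

Section GraphNotions.

Variable G : sgraph.

Definition deg (u : G) : nat := #|[set v : G | adj u v]|.

Definition pendant (u : G) : bool := deg u == 1.

Definition edges : {set {set G}} :=
  [set [set u; v] | u : G, v : G in adj u].

Definition connected : Prop := 0 < #|G| /\ forall u v : G, connect (@adj G) u v.

Definition zagreb1 : nat := \prod_(u : G) deg u ^ 2.

(* For an edge e = {u, v} the inner product is d(u) * d(v). *)
Definition zagreb2 : nat := \prod_(e in edges) \prod_(u in e) deg u.

Definition degree_sequence (s : seq nat) : Prop :=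
  perm_eq [seq deg u | u <- enum G] s.

End GraphNotions.

Definition in_Gnp (n p : nat) (G : sgraph) : Prop :=
  [/\ connected G, #|G| = n & #|[set u : G | pendant u]| = p].

Definition in_An1 (n p : nat) (G : sgraph) : Prop :=
  connected G /\
  degree_sequence G (p :: nseq (n - p - 1) 2 ++ nseq p 1).

(* k and r are meant to be the quotient and remainder of 2n-p-2 by n-p. *)
Definition in_An2 (n p k r : nat) (G : sgraph) : Prop :=
  connected G /\
  degree_sequence G (nseq r k.+1 ++ nseq (n - p - r) k ++ nseq p 1).

(* Main.v *)
Require Import Defs.
From mathcomp Require Import all_boot.
From mathcomp Require Import zify.

(* A connected graph has degree sum at least 2(n - 1), so the n - p non-pendant
   degrees, all at least 2, have sum at least 2n - p - 2; pendant vertices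
   contribute the factor 1.  Hence both bounds concern integer sequences only.
   For the first, (2 + e)(2 + e') >= 2(2 + e + e'), strictly unless e e' = 0:
   the product is least when a single term carries all the excess over 2.
   For the second, the product of the degrees over all edges is that of the
   d(u)^d(u), and x^x is strictly logarithmically convex, so it lies above its
   chord through k and k + 1, with equality only at these two integers. *)

Set Implicit Arguments.
Unset Strict Implicit.
Unset Printing Implicit Defensive.

(** * Degree sums and edge products in a connected graph *)

Section Graph.

Variable G : sgraph.
Implicit Types (u v : G) (S : {set G}).

Lemma card_incident_edges u : #|[set e in edges G | u \in e]| = deg u.
Proof.
rewrite /deg -(@card_in_imset _ _ (fun v => [set u; v])).
  apply: eq_card => e; rewrite !inE; apply/andP/imsetP.
    case=> /imset2P[x y _ xy ->]; rewrite !inE => /orP[] /eqP ->.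
      by exists y; rewrite // inE.
    by exists x; rewrite ?inE 1?adj_sym // setUC.
  case=> v; rewrite inE => uv ->; split; last by rewrite !inE eqxx.
  by apply/imset2P; exists u v.
move=> v w; rewrite !inE => uv uw /setP /(_ v).
rewrite !inE eqxx orbT; case: eqP => [vu|_ /esym/eqP //].
by rewrite vu adj_irrefl in uv.
Qed.

Lemma zagreb2_degE : zagreb2 G = \prod_(u : G) deg u ^ deg u.
Proof.
rewrite /zagreb2 (exchange_big_dep predT) //=; apply: eq_bigr => u _.
rewrite prod_nat_const -card_incident_edges; congr (_ ^ _).
by apply: eq_card => e; rewrite !inE.
Qed.

(** Without such an edge [S] would be closed under adjacency, hence contain everything connected to
    [u]. *)
Lemma connected_exit_edge S u v : connected G -> u \in S -> v \notin S ->
  exists x y, [/\ x \in S, y \notin S & adj x y].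
Proof.
case=> _ conn uS vS.
have [/existsP[x /existsP[y /and3P[xS yS xy]]]|noexit] :=
  boolP [exists x : G, exists y : G, [&& x \in S, y \notin S & adj x y]].
  by exists x, y.
have clS : closed (@adj G) S.
  apply: (intro_closed (sym_connect_sym (@adj_sym G))) => x y xy xS.
  apply: contraNT noexit => yS.
  by apply/existsP; exists x; apply/existsP; exists y; rewrite xS yS xy.
by rewrite -(closed_connect clS (conn u v)) uS in vS.
Qed.

Lemma connected_deg_gt0 u : connected G -> 1 < #|G| -> 0 < deg u.
Proof.
move=> conn n_gt1.
have /subsetPn[v _ vu] : ~~ ([set: G] \subset [set u]).
  by apply/negP => /subset_leq_card; rewrite cardsT cards1 leqNgt n_gt1.
have [x [y [/set1P-> _ uy]]] := connected_exit_edge conn (set11 u) vu.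
by apply/card_gt0P; exists y; rewrite inE.
Qed.

(* A vertex set is grown one vertex at a time along edges leaving it, each step
   adding at least two ordered adjacent pairs. *)
Lemma connected_grow_set m : connected G -> m < #|G| ->
  exists S, #|S| = m.+1 /\ 2 * m <= \sum_(u in S) \sum_(v in S) adj u v.
Proof.
move=> conn; elim: m => [/card_gt0P[u _]|m IHm lt_m].
  by exists [set u]; rewrite cards1.
have [S [cardS sumS]] := IHm (ltnW lt_m).
have [u uS] : exists u, u \in S by apply/card_gt0P; rewrite cardS.
have /subsetPn[v _ vS] : ~~ ([set: G] \subset S).
  by apply/negP => /subset_leq_card; rewrite cardsT cardS leqNgt lt_m.
have [x [y [xS yS xy]]] := connected_exit_edge conn uS vS.
exists (y |: S); rewrite cardsU1 yS cardS; split=> //.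
rewrite big_setU1 //= big_setU1 //= adj_irrefl add0n.
under [X in _ + X]eq_bigr => z _ do rewrite big_setU1 //= adj_sym.
rewrite big_split /= (bigD1 x xS) /= adj_sym xy; lia.
Qed.

Lemma connected_sum_deg : connected G -> 2 * (#|G| - 1) <= \sum_(u : G) deg u.
Proof.
move=> conn; have G_gt0 : 0 < #|G| by case: conn.
have [|S [cardS]] := @connected_grow_set #|G|.-1 conn; first by rewrite prednK.
have -> : S = setT.
  by apply/eqP; rewrite eqEcard subsetT cardS prednK // cardsT leqnn.
rewrite -subn1 => /leq_trans; apply.
under eq_bigl do rewrite inE.
apply: leq_sum => u _; under eq_bigl do rewrite inE.
rewrite /deg -sum1_card [leqRHS]big_mkcond; apply: leq_sum => v _.
by rewrite inE; case: adj.
Qed.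

End Graph.

(** * Products of integers at least 2 with a given sum *)

Lemma size2_le_sumn (s : seq nat) : all (leq 2) s -> 2 * size s <= sumn s.
Proof. by elim: s => //= x s IHs /andP[x_ge2 /IHs]; lia. Qed.

(** The extra factor 2 on the right avoids the exponent [size s - 1], so the induction can start at
    the empty sequence. *)
Lemma prod_ge_excess (s : seq nat) : all (leq 2) s ->
  2 ^ size s * (2 + (sumn s - 2 * size s)) <= 2 * \prod_(d <- s) d
    ?= iff (count (predC1 2) s <= 1).
Proof.
elim: s => [|x s IHs] /=; first by rewrite big_nil.
case/andP=> x_ge2 s_ge2; rewrite big_cons.
have ss := size2_le_sumn s_ge2; have le_s := IHs s_ge2.
(* Zero excess means that all entries are 2; this decides equality when the new entry [x] is not
   2. *)
have count0 : (count (predC1 2) s == 0) = (sumn s - 2 * size s == 0).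
  elim: s s_ge2 {IHs ss le_s} => //= y s IHs /andP[y_ge2 s_ge2].
  have := size2_le_sumn s_ge2; have := IHs s_ge2; lia.
have -> : x + sumn s - 2 * (size s).+1 = (x - 2) + (sumn s - 2 * size s) by lia.
move: (sumn s - 2 * size s) count0 le_s => E count0 le_s.
have p_gt0 : 0 < 2 ^ size s by rewrite expn_gt0.
have [->|x_neq2] := eqVneq x 2.
  rewrite /= !add0n expnS -!mulnA.
  by rewrite (mono_leqif (fun m n => leq_pmul2l (isT : 0 < 2))).
apply/leqifP; rewrite expnS /= add1n ltnS leqn0 count0.
case: eqP => [E0|/eqP E_neq0]; move: count0 le_s.
  rewrite E0 eqxx => /eqP-> /eqTleqif; rewrite addn0 => /(_ isT) prodE.
  by apply/eqP; nia.
by move=> _ [le_s _]; nia.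
Qed.

(** * Strict logarithmic convexity of x^x, by Bernoulli's inequality cleared of denominators *)

Lemma expn_Bernoulli m j : m.+1 ^ j.+1 <= m.+1 * m ^ j + j * m.+1 ^ j.
Proof.
elim: j => [|j IHj]; first by rewrite expn1 expn0 muln1 leq_addr.
have: m ^ j <= m.+1 ^ j by case: (j) => // i; rewrite leq_exp2r.
rewrite !expnS in IHj *; nia.
Qed.

(** As x(x+2) = (x+1)^2 - 1, Bernoulli gives (x(x+2)/(x+1)^2)^x >= 1 - x/(x+1)^2. What remains is
    (x+1)^4 < (x^2+x+1)(x+2)^2. *)
Lemma expnn_log_convex x : (x.+1 ^ x.+1) ^ 2 < x ^ x * x.+2 ^ x.+2.
Proof.
have := expn_Bernoulli (x * x.+2) x.
have -> : (x * x.+2).+1 = x.+1 ^ 2 by lia.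
have -> : (x.+1 ^ x.+1) ^ 2 = x.+1 ^ 2 * (x.+1 ^ 2) ^ x.
  by rewrite -expnS -!expnM mulnC.
rewrite expnMn !(expnS _.+2) (expnS (_ ^ _)).
have : 0 < (x.+1 ^ 2) ^ x by rewrite !expn_gt0.
move: ((x.+1 ^ 2) ^ x) (x ^ x) (x.+2 ^ x) => N a b N_gt0 le_N.
rewrite -(@ltn_pmul2l (x.+1 ^ 2)) ?expn_gt0 //.
have : N * (x.+1 ^ 2 - x) <= x.+1 ^ 2 * (a * b) by rewrite mulnBr; lia.
move/(leq_mul (leqnn (x.+2 ^ 2))).
have : N * x.+1 ^ 4 < N * ((x.+1 ^ 2 - x) * x.+2 ^ 2).
  rewrite ltn_pmul2l //; have -> : x.+1 ^ 2 - x = x * x + x + 1 by lia.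
  lia.
lia.
Qed.

Lemma leq_ltn_mul a b c d : 0 < b -> a <= b -> c < d -> a * c < b * d.
Proof.
move=> b_gt0 le_ab lt_cd; apply: leq_ltn_trans (leq_mul le_ab (leqnn c)) _.
by rewrite ltn_pmul2l.
Qed.

(** * Products of a strictly log-convex function over a sequence *)

Section LogConvex.

Variable h : nat -> nat.
Hypotheses (h_gt0 : forall x, 0 < h x)
  (h_cvx : forall x, h x.+1 ^ 2 < h x * h x.+2).

(** The quotients h(j+1)/h(j) increase strictly: convexity compares neighbours, and induction on [d]
    chains these comparisons, cancelling common factors. *)
Lemma log_convex_ratio i d : h i.+1 * h (i + d).+1 < h i * h (i + d).+2.
Proof.
elim: d => [|d IHd]; first by rewrite addn0 mulnn.
rewrite addnS -(@ltn_pmul2r (h (i + d).+1 * h (i + d).+2)); last first.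
  by rewrite muln_gt0 !h_gt0.
have := ltn_mul IHd (h_cvx (i + d).+1); nia.
Qed.

(* The chord bound: on a logarithmic scale, [h] lies above the line through its
   values at [k] and [k + 1]. *)
Lemma log_convex_chord k x :
  h k ^ k.+1 * h k.+1 ^ x <= h x * h k ^ x * h k.+1 ^ k
    ?= iff (x \in [:: k; k.+1]).
Proof.
have pow_gt0 i e : 0 < h i ^ e by rewrite expn_gt0 h_gt0.
(* h(k+d)/h(k) is a product of [d] quotients, the first equal to h(k+1)/h(k) and the later ones
   larger; strictness starts at d = 2. *)
have chord_up d : h k * h k.+1 ^ d <= h (k + d) * h k ^ d ?= iff (d <= 1).
  elim: d => [|[|d] IHd].
  - by rewrite addn0 !expn0; apply/leqif_refl.
  - by rewrite addn1 !expn1 mulnC; apply/leqif_refl.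
  - apply/leqifP; rewrite ltnS ltn0; rewrite !addnS in IHd *.
    rewrite (expnSr _ d.+1) (expnSr (h k)) -(@ltn_pmul2r (h (k + d).+1)) //.
    move/leq_of_leqif: IHd => le_d; have := log_convex_ratio k d.
    move/(leq_ltn_mul _ le_d); rewrite muln_gt0 h_gt0 pow_gt0 => /(_ isT); lia.
(* Below [k] each of the [d] quotients in h(k)/h(k-d) is smaller than h(k+1)/h(k), so strictness
   starts at d = 1. *)
have chord_down d : d <= k ->
    h k ^ d.+1 <= h (k - d) * h k.+1 ^ d ?= iff (d == 0).
  elim: d => [|d IHd] d_le.
    by rewrite subn0 expn0 expn1 muln1; apply/leqif_refl.
  apply/leqifP; rewrite /= (expnSr _ d.+1) (expnSr (h k.+1)).
  rewrite -(@ltn_pmul2r (h (k - d))) //.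
  have := log_convex_ratio (k - d.+1) d.
  have -> : (k - d.+1).+1 = k - d by lia.
  have -> : (k - d.+1 + d).+2 = k.+1 by lia.
  have -> : (k - d.+1 + d).+1 = k by lia.
  move/leq_of_leqif: (IHd (ltnW d_le)) => /leq_ltn_mul le_d /le_d.
  rewrite muln_gt0 h_gt0 pow_gt0 => /(_ isT); lia.
have [k_le|x_lt] := leqP k x.
  have: x = k + (x - k) by rewrite subnKC.
  move: (x - k) (chord_up (x - k)) => d chord_d ->.
  have -> : (k + d \in [:: k; k.+1]) = (d <= 1) by rewrite !inE; lia.
  move: chord_d; have c_gt0 : 0 < h k ^ k * h k.+1 ^ k.
    by rewrite muln_gt0 !pow_gt0.
  rewrite -(mono_leqif (fun m n => leq_pmul2l c_gt0)).
  have -> : h k ^ k.+1 * h k.+1 ^ (k + d)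
    = h k ^ k * h k.+1 ^ k * (h k * h k.+1 ^ d).
    rewrite !expnD expnS; lia.
  have -> // : h (k + d) * h k ^ (k + d) * h k.+1 ^ k
    = h k ^ k * h k.+1 ^ k * (h (k + d) * h k ^ d).
  rewrite !expnD; lia.
have: k = x + (k - x) by rewrite subnKC // ltnW.
move: (chord_down (k - x) (leq_subr x k)); rewrite subKn 1?ltnW //.
move: (k - x) => d chord_d kE.
have -> : (x \in [:: k; k.+1]) = (d == 0) by rewrite !inE; lia.
move: chord_d; have c_gt0 : 0 < h k ^ x * h k.+1 ^ x.
  by rewrite muln_gt0 !pow_gt0.
rewrite -(mono_leqif (fun m n => leq_pmul2l c_gt0)).
have -> : h k.+1 ^ k = h k.+1 ^ x * h k.+1 ^ d by rewrite -expnD -kE.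
have -> : h k ^ k.+1 = h k ^ x * h k ^ d.+1 by rewrite -expnD addnS -kE.
have -> : h k ^ x * h k ^ d.+1 * h k.+1 ^ x
  = h k ^ x * h k.+1 ^ x * h k ^ d.+1 by lia.
have -> // : h x * h k ^ x * (h k.+1 ^ x * h k.+1 ^ d)
  = h k ^ x * h k.+1 ^ x * (h x * h k.+1 ^ d).
lia.
Qed.

(** The chord inequalities are multiplied over [s]. If the sum exceeds [k * size s + r] by [t], the
    chord bound gains h(k+1)^t where the claim needs only h(k)^t, so equality also forces t = 0. *)
Lemma prod_log_convex_ge k r (s : seq nat) : h k < h k.+1 ->
  r <= size s -> k * size s + r <= sumn s ->
  h k.+1 ^ r * h k ^ (size s - r) <= \prod_(d <- s) h d
    ?= iff all [in [:: k; k.+1]] s && (sumn s == k * size s + r).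
Proof.
move=> h_lt r_le sum_ge.
have pow_gt0 i e : 0 < h i ^ e by rewrite expn_gt0 h_gt0.
have prod_chord :
  h k ^ (k.+1 * size s) * h k.+1 ^ sumn s
    <= (\prod_(d <- s) h d) * h k ^ sumn s * h k.+1 ^ (k * size s)
    ?= iff all [in [:: k; k.+1]] s.
  elim: s {r_le sum_ge} => [|x s IHs] /=.
    by rewrite big_nil !muln0; apply/leqif_refl.
  have := leqif_mul (log_convex_chord k x) IHs.
  (* The equality condition of [leqif_mul] also admits a zero product, which positivity excludes. *)
  rewrite !muln_eq0 !(gtn_eqF (pow_gt0 _ _)) !orbF (gtn_eqF (h_gt0 x)).
  rewrite (gtn_eqF (prodn_gt0 _)) //= big_cons.
  set l := (X in X <= _ ?= iff _); set u := (X in _ <= X ?= iff _).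
  suff [-> ->] : l = h k ^ (k.+1 * (size s).+1) * h k.+1 ^ (x + sumn s) /\
    u = h x * \prod_(j <- s) h j * h k ^ (x + sumn s) *
        h k.+1 ^ (k * (size s).+1) by [].
  by split; rewrite /l /u !mulnS !expnD; lia.
have [t sumE] : exists t, sumn s = k * size s + r + t.
  by exists (sumn s - (k * size s + r)); rewrite subnKC.
set c := h k ^ sumn s * h k.+1 ^ (k * size s).
have c_gt0 : 0 < c by rewrite muln_gt0 !pow_gt0.
rewrite -(mono_leqif (fun m n => leq_pmul2l c_gt0)) andbC.
have -> : c * \prod_(d <- s) h d
  = (\prod_(d <- s) h d) * h k ^ sumn s * h k.+1 ^ (k * size s).
  by rewrite /c; lia.
apply: leqif_trans prod_chord.
have e_gt0 : 0 < h k ^ (k.+1 * size s) * h k.+1 ^ (k * size s + r).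
  by rewrite muln_gt0 !pow_gt0.
have -> : h k ^ (k.+1 * size s) * h k.+1 ^ sumn s =
  h k ^ (k.+1 * size s) * h k.+1 ^ (k * size s + r) * h k.+1 ^ t.
  by rewrite sumE (expnD _ _ t) mulnA.
have -> : c * (h k.+1 ^ r * h k ^ (size s - r)) =
  h k ^ (k.+1 * size s) * h k.+1 ^ (k * size s + r) * h k ^ t.
  rewrite /c.
  have -> : k.+1 * size s = (size s - r) + (k * size s + r) by lia.
  rewrite sumE !expnD; lia.
rewrite (mono_leqif (fun m n => leq_pmul2l e_gt0)).
have -> : (sumn s == k * size s + r) = (t == 0) by rewrite sumE; lia.
apply/leqifP; case: eqVneq => [->|t_neq0]; first by rewrite !expn0.
by rewrite ltn_exp2r // lt0n.
Qed.

End LogConvex.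

(** * Sequences that attain the bounds, up to permutation *)

Lemma filter_pred1 (T : eqType) (x : T) (s : seq T) :
  filter (pred1 x) s = nseq (count_mem x s) x.
Proof. by rewrite -size_filter; apply/all_pred1P/filter_all. Qed.

(** The sum determines the only entry that can differ from 2; if there is none, then q = 0. *)
Lemma perm_eq_one_excess q (s : seq nat) :
  0 < size s -> count (predC1 2) s <= 1 -> sumn s = 2 * size s + q ->
  perm_eq s (q + 2 :: nseq (size s - 1) 2).
Proof.
move=> s_gt0 count_le sumE; have := perm_filterC (pred1 2) s.
rewrite filter_pred1 => /permPl s_perm.
have sumS := perm_sumn s_perm; have sizeS := perm_size s_perm.
rewrite sumE in sumS; move: count_le s_perm s_gt0 sumS sizeS.
rewrite -size_filter sumn_cat sumn_nseq size_cat size_nseq.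
move: (filter (predC1 2) s) (count_mem 2 s) (size s).
case=> [|y []] //= c m _ /permPl s_perm m_gt0 sumS sizeS.
  rewrite -s_perm cats0; have -> : q = 0 by lia.
  by have -> : c = (m - 1).+1 by lia.
rewrite -s_perm; have -> : q + 2 = y by lia.
have -> : m - 1 = c by lia.
by rewrite cats1 perm_rcons perm_refl.
Qed.

Lemma perm_eq_two_values k r (s : seq nat) :
  all [in [:: k; k.+1]] s -> sumn s = k * size s + r ->
  perm_eq s (nseq r k.+1 ++ nseq (size s - r) k).
Proof.
move=> s_all sumE; have := perm_filterC (pred1 k) s.
have -> : filter (predC (pred1 k)) s = filter (pred1 k.+1) s.
  by apply: eq_in_filter => x /(allP s_all); rewrite !inE; lia.
rewrite !filter_pred1 => /permPl s_perm.
have := perm_sumn s_perm; have := perm_size s_perm.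
rewrite sumE size_cat sumn_cat !sumn_nseq !size_nseq => sizeE sumE'.
have rE : r = count_mem k.+1 s by rewrite -sizeE in sumE'; lia.
by rewrite -(permPl s_perm) rE perm_catC -sizeE addnK perm_refl.
Qed.

(** * From integer sequences back to graphs *)

Theorem theorem5p5 (n p k r : nat) (G : sgraph)
    (hp : 2 <= p) (hpn : p < n) (hG : in_Gnp n p G)
    (hk : 2 <= k) (hr : r <= n - p - 1)
    (hkr : 2 * n - p - 2 = k * (n - p) + r) :
  p ^ 2 * 2 ^ (2 * (n - p - 1)) <= zagreb1 G /\
  (k + 1) ^ (r * (k + 1)) * k ^ (k * (n - p - r)) <= zagreb2 G /\
  (zagreb1 G = p ^ 2 * 2 ^ (2 * (n - p - 1)) <-> in_An1 n p G) /\
  (zagreb2 G = (k + 1) ^ (r * (k + 1)) * k ^ (k * (n - p - r)) <->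
     in_An2 n p k r G).
Proof.
have [conn cardG cardP] := hG.
set degs := [seq deg u | u <- enum G].
pose s := filter (predC1 1) degs.
have s_perm : perm_eq degs (s ++ nseq p 1).
  rewrite perm_sym -(permPr (permEl (perm_filterC (predC1 1) degs))) perm_cat2l.
  have -> : filter (predC (predC1 1)) degs = filter (pred1 1) degs.
    by apply: eq_filter => x /=; rewrite negbK.
  rewrite filter_pred1 count_map -cardP cardsE cardE.
  rewrite enumT /enum_mem size_filter.
  by rewrite perm_refl.
have sizeS : size s = n - p.
  by have := perm_size s_perm; rewrite size_map -cardE cardG
    size_cat size_nseq; lia.
have s_ge2 : all (leq 2) s.
  apply/allP => d; rewrite mem_filter => /andP[/= d_neq1 /mapP[u _ dE]].
  by have := connected_deg_gt0 u conn; rewrite -dE; lia.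
have sum_ge : k * size s + r <= sumn s.
  have := connected_sum_deg conn.
  have -> : \sum_(u : G) deg u = sumn degs by rewrite sumnE big_map big_enum.
  by rewrite (perm_sumn s_perm) sumn_cat sumn_nseq sizeS cardG; lia.
(* The condition [f 1 = 1] makes pendant vertices drop out of the product; it holds for both d^2 and
   d^d. *)
have zagrebE (f : nat -> nat) : f 1 = 1 ->
    \prod_(u : G) f (deg u) = \prod_(d <- s) f d.
  move=> f1; rewrite -big_enum -(big_map (@deg G) predT f) (perm_big _ s_perm).
  by rewrite big_cat /= [X in _ * X]big_nseq f1 iter_fix ?muln1.
have seqE t : degree_sequence G (t ++ nseq p 1) <-> perm_eq s t.
  by rewrite /degree_sequence (permPl s_perm) perm_cat2r.
rewrite !addn1 /zagreb1 (zagrebE (expn^~ 2)) //.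
rewrite zagreb2_degE (zagrebE (fun d => d ^ d)) //.
have prodX : \prod_(d <- s) d ^ 2 = (\prod_(d <- s) d) ^ 2.
  by apply/esym/(big_morph (expn^~ 2)) => // x y; rewrite expnMn.
have bound1E : p ^ 2 * 2 ^ (2 * (n - p - 1)) = (p * 2 ^ (n - p - 1)) ^ 2.
  by rewrite expnMn -expnM [_ * 2]mulnC.
have bound2E : k.+1 ^ (r * k.+1) * k ^ (k * (n - p - r)) =
    (k.+1 ^ k.+1) ^ r * (k ^ k) ^ (size s - r).
  by rewrite -!expnM sizeS [r * _]mulnC.
(* Positivity is required at 0 too, where [0 ^ 0 = 1]. *)
have expnn_gt0 x : 0 < x ^ x by case: x => // x; rewrite expn_gt0.
have expnn_lt : k ^ k < k.+1 ^ k.+1.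
  by rewrite (@leq_trans (k.+1 ^ k)) ?ltn_exp2r ?leq_pexp2l //; lia.
have bound2 := prod_log_convex_ge expnn_gt0 expnn_log_convex expnn_lt
  (_ : r <= size s) sum_ge.
rewrite bound2E; have {}bound2 := bound2 ltac:(lia).
have pow_gt0 : 0 < 2 ^ (n - p - 1) by rewrite expn_gt0.
(* By [hkr] the sum is at least 2n - p - 2, which is 2(n - p) + (p - 2). *)
have q_ge : p <= 2 + (sumn s - 2 * size s)
  by clear -sum_ge hkr sizeS hk hr hpn hp; nia.
have bound1 : 2 ^ (n - p - 1) * (2 + (sumn s - 2 * size s))
    <= \prod_(d <- s) d ?= iff (count (predC1 2) s <= 1).
  have := prod_ge_excess s_ge2.
  have -> : size s = (n - p - 1).+1 by rewrite sizeS subn1 prednK ?subn_gt0.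
  by rewrite expnS -mulnA (mono_leqif (fun m n => leq_pmul2l (isT : 0 < 2))).
have le1 : p * 2 ^ (n - p - 1) <= \prod_(d <- s) d.
  by rewrite mulnC (leq_trans _ (leq_of_leqif bound1)) // leq_pmul2l.
rewrite prodX bound1E leq_sqr; split=> //.
split; first exact: leq_of_leqif bound2.
split; split.
- move/eqP; rewrite eqn_sqr => /eqP prodE.
  split=> //; apply/(seqE (p :: nseq _ _)).
  (* At equality the product is [p * 2 ^ (n - p - 1)], so [bound1] bounds the excess from above as
     well. *)
  have excessE : 2 + (sumn s - 2 * size s) = p.
    apply/eqP; rewrite eqn_leq q_ge andbT.
    by have := leq_of_leqif bound1; rewrite prodE mulnC leq_pmul2r.
  have count_le : count (predC1 2) s <= 1.
    by rewrite -(eq_leqif bound1) excessE prodE mulnC.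
  rewrite -sizeS -(subnK hp); apply: perm_eq_one_excess => //.
    by rewrite sizeS subn_gt0.
  by rewrite -excessE addKn subnKC ?size2_le_sumn.
- case=> _ /(seqE (p :: nseq _ _)) s_eq.
  by rewrite (perm_big _ s_eq) big_cons big_nseq iter_muln muln1.
- move=> prodE; split=> //; rewrite catA; apply/seqE.
  move: (eq_leqif bound2); rewrite prodE eqxx => /esym/andP[s_all /eqP sumE].
  by rewrite -sizeS; apply: perm_eq_two_values.
- case=> _; rewrite catA => /seqE s_eq.
  by rewrite (perm_big _ s_eq) big_cat !big_nseq !iter_muln !muln1 sizeS.
Qed.
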